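(* Let the errors satisfy Assumption A (see context), let $\Sigma=\operatorname{cov}(\mathbf e_1(d))$, let $\mathbf M$ be a symmetric positive definite $d\times d$ matrix, and let $\boldsymbol\Delta_d\in\mathbb R^d$, $\boldsymbol\Delta_d\ne\mathbf 0$. Put $\mathbf o_M=\mathbf M^{-1}\boldsymbol\Delta_d$ and suppose $\mathbf o_M^T\Sigma\,\mathbf o_M\ne0$. Then $$\mathcal E_1^2(\boldsymbol\Delta_d,\mathbf o_M)\ \ge\ \frac{\|\mathbf M^{-1/2}\boldsymbol\Delta_d\|^2}{\operatorname{tr}(\mathbf M^{-1/2}\Sigma\,\mathbf M^{-1/2})},$$ where $\operatorname{tr}$ denotes the trace, and equality holds if and only if there is only one common factor which is weighted proportionally to $\boldsymbol\Delta_d$ (i.e. $\mathbf a_j(d)$ is a scalar multiple of $\boldsymbol\Delta_d$ for every $j\ge1$, so that $\mathbf e_t(d)=\xi_t\,\boldsymbol\Delta_d$ for a scalar random variable $\xi_t$).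
   Context: $\mathcal E_1(\boldsymbol\Delta_d,\mathbf p_d)=|\langle\boldsymbol\Delta_d,\mathbf p_d\rangle|/\tau(\mathbf p_d)$ with $\tau^2(\mathbf p_d)=\mathbf p_d^T\Sigma\,\mathbf p_d$ (the high dimensional efficiency of change point tests based on projecting the data onto $\mathbf p_d$ when the change is $\boldsymbol\Delta_d$). $\mathbf M^{-1/2}$ is the inverse of the symmetric positive definite square root of $\mathbf M$; $\|\cdot\|$ is the Euclidean norm. $\mathbf o_M$ is called the misscaled oracle. Assumption A: for each $d$, $\eta_{1,t}(d),\eta_{2,t}(d),\ldots$ are independent with mean $0$, variance $1$ and $\operatorname E|\eta_{i,t}(d)|^\nu\le C<\infty$ for some $\nu>2$ and all $i,d$; for $t=1,\ldots,T$ the sequences $(\eta_{1,t}(d),\eta_{2,t}(d),\ldots)$ are independent and identically distributed; and the error vectors are $\mathbf e_t(d)=\sum_{j\ge1}\mathbf a_j(d)\,\eta_{j,t}(d)$ with deterministic $\mathbf a_j(d)=(a_{1,j}(d),\ldots,a_{d,j}(d))^T$, $\sum_{j\ge1}a_{l,j}(d)^2<\infty$ for $l=1,\ldots,d$. Hence $\Sigma=\sum_{j\ge1}\mathbf a_j(d)\mathbf a_j(d)^T$. *)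

(* Defs.v *)
From HB Require Import structures.
From mathcomp Require Import all_boot all_order all_algebra.
From mathcomp Require Import all_classical all_reals all_analysis.

Set Implicit Arguments.
Unset Strict Implicit.
Unset Printing Implicit Defensive.

Import Order.TTheory GRing.Theory Num.Theory.
Import numFieldNormedType.Exports.

Local Open Scope classical_set_scope.
Local Open Scope ring_scope.

Section linear_algebra.
Context {R : realType} {d : nat}.
Implicit Types (x y p : 'cV[R]_d) (M Sigma : 'M[R]_d).

Definition inner x y : R := (x^T *m y) 0 0.

(* The library norm on matrices is the max norm, not the Euclidean one. *)
Definition enorm x : R := Num.sqrt (inner x x).

Definition sym_posdef M : Prop :=
  M^T = M /\ forall x, x != 0 -> 0 < inner x (M *m x).

(* Defined through choice; the default value 0 is irrelevant when M is
   symmetric positive definite, since the root then exists and is unique. *)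
Definition sqrtmx M : 'M[R]_d :=
  xget 0 [set N : 'M[R]_d | sym_posdef N /\ N *m N = M].

Definition invsqrtmx M : 'M[R]_d := invmx (sqrtmx M).

Definition tau Sigma p : R := Num.sqrt (inner p (Sigma *m p)).

(* High dimensional efficiency of the tests based on projecting the data onto
   p, when the change is Delta and the errors have covariance Sigma. *)
Definition efficiency Sigma Delta p : R := `|inner Delta p| / tau Sigma p.

Definition misscaled_oracle M Delta : 'cV[R]_d := invmx M *m Delta.

Definition one_proportional_factor (a : nat -> 'cV[R]_d) Delta : Prop :=
  forall j, exists c : R, a j = c *: Delta.

End linear_algebra.

Section probability.
Context {R : realType} {disp : measure_display} {Om : measurableType disp}.
Variable P : probability Om R.

Definition mutually_independent {I : eqType} (F : I -> set (set Om)) : Prop :=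
  forall (J : seq I) (A : I -> set Om), uniq J ->
    (forall i, i \in J -> F i (A i)) ->
    P (\bigcap_(i in [set` J]) A i) = (\prod_(i <- J) P (A i))%E.

(* X is a family of random elements of S, where S carries the
   sigma-algebra G. *)
Definition independent_elements {I : eqType} {S : Type} (G : set (set S))
    (X : I -> Om -> S) : Prop :=
  mutually_independent (fun i => preimage_set_system setT (X i) G).

Definition identically_distributed {I S : Type} (G : set (set S))
    (X : I -> Om -> S) : Prop :=
  forall (i i' : I) (B : set S), G B -> P (X i @^-1` B) = P (X i' @^-1` B).

(* The product of the Borel sigma-algebras on R^nat. *)
Definition product_borel : set (set (nat -> R)) :=
  <<s \bigcup_(j in [set: nat])
        preimage_set_system setT (fun x : nat -> R => x j) measurable >>.

Definition covmx {d : nat} (X : 'I_d -> {RV P >-> R}) : 'M[R]_d :=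
  \matrix_(k, l) fine (covariance P (X k) (X l)).

(* The first argument d of eta, a and e is the dimension; the time points
   1, ..., T are represented by 'I_T and the factor indices j >= 1 by nat, both
   shifted to start at 0. Thus eta d t j is eta_{j+1,t+1}(d), a d j is
   a_{j+1}(d), and e d t l is the l-th component of e_{t+1}(d). The exponent nu
   and the bound C do not depend on d. *)
Record assumption_A {T : nat}
    (eta : forall d : nat, 'I_T -> nat -> {RV P >-> R})
    (a : forall d : nat, nat -> 'cV[R]_d)
    (e : forall d : nat, 'I_T -> 'I_d -> {RV P >-> R}) : Prop := AssumptionA {
  eta_indep : forall d t,
    independent_elements (measurable : set (set R))
      (fun j => eta d t j : Om -> R) ;
  eta_mean : forall d t j, ('E_P[eta d t j] = 0)%E ;
  eta_variance : forall d t j, ('V_P[eta d t j] = 1)%E ;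
  eta_moment : exists nu C : R, 2 < nu /\
    forall d t j, ('E_P[(fun w => `|eta d t j w| `^ nu)%R] <= C%:E)%E ;
  eta_time_indep : forall d,
    independent_elements product_borel (fun t w j => eta d t j w) ;
  eta_time_ident : forall d,
    identically_distributed product_borel (fun t w j => eta d t j w) ;
  a_square_summable : forall d (l : 'I_d),
    cvgn (series (fun j => a d j l 0 ^+ 2)) ;
  (* the infinite sum defining the errors converges almost surely *)
  e_expansion : forall d t (l : 'I_d),
    {ae P, forall w,
      series (fun j => a d j l 0 * eta d t j w) @ \oo --> e d t l w}
}.

End probability.

(* Main.v *)
(* Write L = M^(-1/2) and u = L Delta, so that o_M = L u. The almost sure series
   defining the errors also converges in mean square, by Fatou's lemma and the
   orthonormality of the eta's; hence Sigma = sum_j a_j a_j^T. Consequently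
     |u|^2 tr (L Sigma L) - o_M^T Sigma o_M
       = sum_j (|u|^2 |L a_j|^2 - <u, L a_j>^2),
   a series of Cauchy-Schwarz gaps: it is nonnegative, and it vanishes exactly
   when every L a_j is a multiple of u, i.e. every a_j is a multiple of Delta.
   The theorem follows by dividing, since <Delta, o_M> = |u|^2. *)

Require Import Defs.
From HB Require Import structures.
From mathcomp Require Import all_boot all_order all_algebra.
From mathcomp Require Import all_classical all_reals all_analysis.
From mathcomp Require Import measurable_realfun complex ring lra.

Set Implicit Arguments.
Unset Strict Implicit.
Unset Printing Implicit Defensive.

Import Order.TTheory GRing.Theory Num.Theory.
Import numFieldNormedType.Exports.

Local Open Scope classical_set_scope.
Local Open Scope ring_scope.

(** * Series of nonnegative terms and polynomial interpolation *)

Lemma nonneg_series_lim (R : realType) (q : nat -> R) (l : R) :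
  (forall j, 0 <= q j) -> series q @ \oo --> l ->
  0 <= l /\ (l = 0 <-> forall j, q j = 0).
Proof.
move=> q0 ql.
have sq n : series q n <= l.
  rewrite -(cvg_lim _ ql)//; apply: nondecreasing_cvgn_le.
    by apply/nondecreasing_seqP => k; rewrite /series/= big_nat_recr//= lerDl.
  by apply/cvg_ex; exists l.
have l0 : 0 <= l by have := sq 0%N; rewrite /series/= big_geq.
split=> //; split=> [lE j|q00].
  (* The partial sum of index [j.+1] is the first that contains [q j]. *)
  apply/eqP; rewrite eq_le q0 andbT -lE; apply: le_trans (sq j.+1).
  by rewrite /series/= big_nat_recr//= lerDr sumr_ge0.
apply: (cvg_unique _ ql) => //.
rewrite (_ : series q = cst 0); first exact: cvg_cst.
by apply/funext => n; rewrite /series/= big1.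
Qed.

(** Newton's scheme: a new node [y] is served by adding a multiple of a product [w] of linear
    factors that vanishes on the old nodes but not at [y]. *)
Lemma poly_interpolation (F : fieldType) (s : seq F) (f : F -> F) :
  exists p : {poly F}, {in s, forall x, p.[x] = f x}.
Proof.
elim: s => [|y s [p Hp]]; first by exists 0.
have [ys|ys] := boolP (y \in s).
  by exists p => x; rewrite inE => /predU1P[->|]; exact: Hp.
pose w := \prod_(z <- s) ('X - z%:P).
have wy0 : w.[y] != 0 by rewrite -[_ == 0]/(root w y) root_prod_XsubC.
exists (p + ((f y - p.[y]) / w.[y]) *: w) => x.
rewrite inE hornerD hornerZ => /predU1P[->|xs].
  by rewrite divfK// addrC subrK.
have /rootP -> : root w x by rewrite root_prod_XsubC.
by rewrite mulr0 addr0 Hp.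
Qed.

(** * Euclidean inner product, Cauchy-Schwarz gaps, positive definite matrices *)

Section inner_product.
Context {R : realType} {d : nat}.
Implicit Types (x y z : 'cV[R]_d) (A M : 'M[R]_d).

Lemma innerE x y : inner x y = \sum_i x i 0 * y i 0.
Proof. by rewrite /inner mxE; apply: eq_bigr => i _; rewrite mxE. Qed.

Lemma innerC x y : inner x y = inner y x.
Proof. by rewrite !innerE; apply: eq_bigr => i _; rewrite mulrC. Qed.

Lemma innerZr a x y : inner x (a *: y) = a * inner x y.
Proof. by rewrite /inner -scalemxAr mxE. Qed.

Lemma innerZl b x y : inner (b *: x) y = b * inner x y.
Proof. by rewrite innerC innerZr innerC. Qed.

Lemma innerBr x y z : inner x (y - z) = inner x y - inner x z.
Proof. by rewrite /inner mulmxBr !mxE. Qed.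

Lemma inner_mulmxr A x y : inner x (A *m y) = inner (A^T *m x) y.
Proof. by rewrite /inner trmx_mul trmxK mulmxA. Qed.

Lemma inner_ge0 x : 0 <= inner x x.
Proof. by rewrite innerE sumr_ge0// => i _; rewrite -expr2 sqr_ge0. Qed.

Lemma inner_eq0 x : (inner x x == 0) = (x == 0).
Proof.
apply/idP/eqP => [|->]; last by rewrite /inner mulmx0 mxE.
rewrite innerE psumr_eq0 => [/allP x0|i _]; last by rewrite -expr2 sqr_ge0.
apply/colP => i; rewrite mxE; apply/eqP.
by have := x0 i; rewrite mem_index_enum mulf_eq0 orbb => /(_ isT).
Qed.

Lemma inner_gt0 x : x != 0 -> 0 < inner x x.
Proof. by rewrite lt_def inner_ge0 inner_eq0 andbT. Qed.

(* The gap in the Cauchy-Schwarz inequality for [x] and [y] is, up to the factor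
   [inner x x], the squared norm of the component of [y] orthogonal to [x]. *)
Lemma Cauchy_Schwarz_gap x y :
  let z := inner x x *: y - inner x y *: x in
  inner x x * (inner x x * inner y y - inner x y ^+ 2) = inner z z.
Proof.
rewrite /= innerBr !innerZr ![inner (_ - _) _]innerC !innerBr !innerZr.
by rewrite [inner y x]innerC; ring.
Qed.

(** When the gap vanishes, so does the vector of [Cauchy_Schwarz_gap], and
    [inner x x *: y = inner x y *: x] can be solved for [y]. *)
Lemma scale_multipleP x y : x != 0 ->
  (exists c, y = c *: x) <->
  inner x x * inner y y - inner x y ^+ 2 = 0.
Proof.
move=> x0; have xx := inner_gt0 x0; split=> [[c ->]|gap0].
  by rewrite !innerZr !innerZl; ring.
have := Cauchy_Schwarz_gap x y; rewrite /= gap0 mulr0 => /esym/eqP.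
rewrite inner_eq0 subr_eq0 => /eqP xy; exists (inner x y / inner x x).
by rewrite mulrC -scalerA -xy scalerA mulVf ?scale1r// gt_eqF.
Qed.

Lemma Cauchy_Schwarz x y : 0 <= inner x x * inner y y - inner x y ^+ 2.
Proof.
have [->|x0] := eqVneq x 0; first by rewrite /inner trmx0 !mul0mx !mxE; lra.
by rewrite -(pmulr_rge0 _ (inner_gt0 x0)) Cauchy_Schwarz_gap inner_ge0.
Qed.

Lemma sym_posdef_eigenvalue_gt0 M a : sym_posdef M -> eigenvalue M a -> 0 < a.
Proof.
move=> [Msym Mpos] /eigenvalueP[v vM v0].
(* [eigenvalue] refers to row eigenvectors; transposition and the symmetry of [M] turn [v] into a
   column. *)
have v0' : v^T != 0 by rewrite trmx_eq0.
have := Mpos _ v0'.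
rewrite -[in M *m _]Msym -trmx_mul vM linearZ/= innerZr.
by rewrite pmulr_lgt0// inner_gt0.
Qed.

Lemma sym_posdef_unit M : sym_posdef M -> M \in unitmx.
Proof.
move=> [Msym Mpos]; rewrite -row_free_unit -kermx_eq0; apply/rowV0P => v.
move=> /sub_kermxP vM; apply/eqP; rewrite -trmx_eq0; apply: contraT => v0.
have := Mpos _ v0.
by rewrite -[in M *m _]Msym -trmx_mul vM trmx0 /inner mulmx0 mxE ltxx.
Qed.

End inner_product.

(** * Existence of the symmetric positive definite square root *)

Section square_root.
Context {R : realType}.

(* A real symmetric matrix is diagonalizable over the complex numbers with real
   eigenvalues. *)
Lemma sym_mx_annihilator n (M : 'M[R]_n.+1) : M^T = M ->
  exists2 s : seq R, {in s, forall x, eigenvalue M x} &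
    forall p : {poly R}, {in s, forall x, p.[x] = 0} -> horner_mx M p = 0.
Proof.
move=> Msym; pose A := map_mx (real_complex R) M.
have Aherm : A \is hermsymmx.
  apply: realsym_hermsym.
    by apply/is_hermitianmxP; rewrite expr0 scale1r map_mx_id//
      /A map_trmx Msym.
  by apply/mxOverP => i j; rewrite mxE complex_real.
have Dreal := hermitian_spectral_diag_real Aherm.
have /orthomx_spectralP := hermitian_normalmx Aherm.
set P := spectralmx A; set D := spectral_diag A => AE.
have Punit : P \in unitmx by exact: spectral_unit.
have ReD i : (real_complex R) (complex.Re (D 0 i)) = D 0 i.
  by apply: RRe_real; exact: (mxOverP Dreal).
exists [seq complex.Re (D 0 i) | i : 'I_n.+1] => [x /mapP[i _ ->]|p ps].
  (* Eigenvalues may be tested over the complex numbers, where row [i] of [P] is an eigenvector,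
     nonzero because [P] is invertible. *)
  rewrite -(eigenvalue_map (real_complex R)) [X in eigenvalue _ X]ReD.
  apply/eigenvalueP; exists (row i P).
    rewrite -/A AE mulmxA mulmxA -row_mul mulmxV// row1 -rowE row_diag_mx.
    by rewrite -scalemxAl -rowE.
  apply: contraL Punit => /eqP Pi0; rewrite -row_free_unit -kermx_eq0.
  apply/rowV0Pn; exists (delta_mx 0 i).
    by apply/sub_kermxP; rewrite -rowE.
  by apply/eqP => /matrixP/(_ 0 i)/eqP; rewrite !mxE !eqxx oner_eq0.
(* Evaluating [p] at [A] gives a conjugate of [p] applied to the diagonal [D], which is zero entry
   by entry. *)
apply: (@map_mx_inj _ _ (real_complex R)); rewrite map_mx0 map_horner_mx -/A AE.
rewrite horner_mx_uconjC// horner_mx_diag (_ : map_mx _ D = 0).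
  by rewrite linear0 mulmx0 mul0mx.
apply/rowP => i; rewrite !mxE -ReD horner_map ps ?rmorph0//.
by apply/mapP; exists i; rewrite ?mem_enum.
Qed.

Lemma horner_mx_sym n (M : 'M[R]_n.+1) (p : {poly R}) :
  M^T = M -> (horner_mx M p)^T = horner_mx M p.
Proof.
move=> Msym; elim/poly_ind: p => [|p c IH]; first by rewrite rmorph0 trmx0.
rewrite !rmorphD !rmorphM/= horner_mx_X horner_mx_C linearD/= tr_scalar_mx.
rewrite -mulmxE trmx_mul Msym IH; congr (_ + _).
exact: comm_mx_horner (comm_mx_refl M).
Qed.

(* The square root is taken as [Q ^+ 2] with [Q] a symmetric fourth root of [M],
   obtained by interpolation on the spectrum: as a square of a symmetric
   invertible matrix it is automatically positive definite. *)
Lemma sym_posdef_sqrt_ex d (M : 'M[R]_d) : sym_posdef M ->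
  exists N : 'M[R]_d, sym_posdef N /\ N *m N = M.
Proof.
(* [horner_mx] is used in nonzero size; in size 0 all matrices coincide. *)
case: d M => [|n] M Mpd.
  by exists M; split=> //; rewrite [LHS]flatmx0 [RHS]flatmx0.
have [s sM sann] := sym_mx_annihilator Mpd.1.
have [q qE] := poly_interpolation s (fun x => Num.sqrt (Num.sqrt x)).
set Q := horner_mx M q.
have QM : (Q * Q) * (Q * Q) = M.
  (* The fourth power of [q] minus ['X] vanishes on the spectrum, whose elements are positive, so it
     annihilates [M]. *)
  apply/eqP; rewrite -subr_eq0 -[X in _ - X](horner_mx_X M).
  rewrite -!rmorphM -rmorphB; apply/eqP/sann => x xs.
  rewrite hornerD hornerN !hornerM hornerX qE// -!expr2 sqr_sqrtr ?sqrtr_ge0//.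
  by rewrite sqr_sqrtr ?subrr// ltW// (sym_posdef_eigenvalue_gt0 Mpd) ?sM.
have Qsym : Q^T = Q by apply: horner_mx_sym; exact: Mpd.1.
exists (Q *m Q); split; last exact: QM.
split; first by rewrite trmx_mul Qsym.
move=> x x0; rewrite -mulmxA inner_mulmxr Qsym inner_gt0//.
(* As [M] is the fourth power of [Q], [Q *m x = 0] would give [M *m x = 0], and [M] is
   invertible. *)
apply: contraNneq x0 => Qx.
have := sym_posdef_unit Mpd; rewrite -QM -!mulmxE => MU.
rewrite -[x](mulKmx MU).
by rewrite -!mulmxA Qx !mulmx0.
Qed.

Lemma sqrtmxP d (M : 'M[R]_d) : sym_posdef M ->
  sym_posdef (sqrtmx M) /\ sqrtmx M *m sqrtmx M = M.
Proof. by move=> /sym_posdef_sqrt_ex; exact: xgetPex. Qed.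

Lemma invsqrtmx_sym d (M : 'M[R]_d) : sym_posdef M ->
  (invsqrtmx M)^T = invsqrtmx M.
Proof. by move=> /sqrtmxP[[Nsym _] _]; rewrite /invsqrtmx trmx_inv Nsym. Qed.

Lemma invsqrtmx_unit d (M : 'M[R]_d) : sym_posdef M ->
  invsqrtmx M \in unitmx.
Proof. by move=> /sqrtmxP[Npd _]; rewrite unitmx_inv sym_posdef_unit. Qed.

Lemma invsqrtmx_sqr d (M : 'M[R]_d) : sym_posdef M ->
  invsqrtmx M *m invsqrtmx M = invmx M.
Proof.
move=> /[dup] Mpd /sqrtmxP[Npd NM].
have NU := sym_posdef_unit Npd.
rewrite -[LHS](mulmxK (sym_posdef_unit Mpd)) -[X in _ *m X *m _]NM /invsqrtmx.
by rewrite !mulmxA mulmxKV// mulVmx// mul1mx.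
Qed.

End square_root.

(** * Square integrability, independence and the product rule for expectations *)

Section independence.
Local Open Scope ereal_scope.
Context {R : realType} {disp : measure_display} {Om : measurableType disp}.
Variable P : probability Om R.

Lemma Lfun2_expectation_sqr (X : {RV P >-> R}) :
  'E_P[(X : Om -> R) * X] < +oo -> (X : Om -> R) \in Lfun P 2%:E.
Proof.
rewrite unlock => X2.
rewrite inE; apply/andP; split; rewrite inE//=.
rewrite /finite_norm unlock poweR_lty// (le_lt_trans _ X2)//.
apply: ge0_le_integral => //.
- by move=> x _; rewrite lee_fin powR_ge0.
- apply/measurable_EFinP.
  apply: (@measurableT_comp _ _ _ _ _ _ (fun x : R => x `^ 2)%R) => //.
  exact: measurableT_comp.
- by apply/measurable_EFinP; exact: measurable_funM.
- move=> x _ /=.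
  by rewrite lee_fin powR_mulrn// -normrX ger0_norm ?sqr_ge0// expr2.
Qed.

(** The joint law agrees with the product of the marginal laws on rectangles, hence everywhere by
    uniqueness of the product measure; Fubini's theorem then splits the integral of [z.1 * z.2]. *)
Lemma expectation_indepM (X Y : {RV P >-> R}) :
  (forall A B, measurable A -> measurable B ->
    P (X @^-1` A `&` Y @^-1` B) = P (X @^-1` A) * P (Y @^-1` B)) ->
  (X : Om -> R) \in Lfun P 1 -> (Y : Om -> R) \in Lfun P 1 ->
  ((X : Om -> R) * Y)%R \in Lfun P 1 ->
  'E_P[(X : Om -> R) * Y] = 'E_P[X] * 'E_P[Y].
Proof.
move=> indXY /Lfun1_integrable iX /Lfun1_integrable iY /Lfun1_integrable iXY.
have mXY : measurable_fun setT (fun w => (X w, Y w)).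
  exact: measurable_fun_pair.
pose Z : {mfun Om >-> (R * R)%type} :=
  HB.pack (fun w => (X w, Y w)) (isMeasurableFun.Build _ _ _ _ _ mXY).
pose mX := distribution P X; pose mY := distribution P Y.
have prodE A : measurable A -> (mX \x mY) A = distribution P Z A.
  by apply: product_measure_unique => B C mB mC; exact: indXY.
pose f (z : R * R) : \bar R := (z.1 * z.2)%:E.
have mf : measurable_fun setT f.
  by apply/measurable_EFinP; exact: measurable_funM.
have EZ (g : R * R -> \bar R) :
    \int[mX \x mY]_z g z = \int[distribution P Z]_z g z.
  by apply: eq_measure_integral => A mA _; exact: prodE.
have iZ : (distribution P Z).-integrable setT f.
  exact: integrable_pushforward.
have ifp : (mX \x mY).-integrable setT f.
  by apply/integrableP; split => //; rewrite EZ; case/integrableP : iZ.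
rewrite unlock.
transitivity (\int[distribution P Z]_z f z).
  by rewrite integral_distribution.
rewrite -EZ -integral12_prod_meas1// /fubini_F/=.
have EY x : \int[mY]_y f (x, y) = x%:E * \int[P]_w (Y w)%:E.
  have iY' : mY.-integrable setT EFin.
    by apply: integrable_pushforward => //; exact/measurable_EFinP.
  under eq_integral do rewrite /f/= EFinM.
  rewrite integralZl//; congr (_ * _).
  by rewrite integral_distribution//; exact/measurable_EFinP.
under eq_integral do rewrite EY.
have iX' : mX.-integrable setT EFin.
  by apply: integrable_pushforward => //; exact/measurable_EFinP.
rewrite -(fineK (integrable_fin_num measurableT iY)) integralZr//.
by congr (_ * _); rewrite integral_distribution//; exact/measurable_EFinP.
Qed.

Lemma independent_elements_pair (I : eqType) (X : I -> {RV P >-> R}) i j :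
  independent_elements P (measurable : set (set R)) (fun k => X k : Om -> R) ->
  i != j -> forall A B, measurable A -> measurable B ->
    P (X i @^-1` A `&` X j @^-1` B) = P (X i @^-1` A) * P (X j @^-1` B).
Proof.
move=> indX ij A B mA mB.
(* Independence asks for a set at every index; only the values at [i] and [j] enter the
   intersection. *)
pose C k := if k == i then X i @^-1` A else X j @^-1` B.
have Ci : C i = X i @^-1` A by rewrite /C eqxx.
have Cj : C j = X j @^-1` B by rewrite /C eq_sym (negbTE ij).
have := indX [:: i; j] C; rewrite !big_cons big_nil mule1 Ci Cj => <-//.
- congr (P _); apply/seteqP; split=> [w [Aw Bw] k /=|w Cw].
    by rewrite !inE => /orP[] /eqP ->; rewrite ?Ci ?Cj.
  split; first by rewrite -Ci; apply: Cw; rewrite /= !inE eqxx.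
  by rewrite -Cj; apply: Cw; rewrite /= !inE eqxx orbT.
- by rewrite /= inE ij.
- move=> k; rewrite !inE => /orP[] /eqP ->; rewrite ?Ci ?Cj.
    by exists A => //; rewrite setTI.
  by exists B => //; rewrite setTI.
Qed.

End independence.

(** * Second moments and almost sure limits *)

Section square_integrable.
Local Open Scope ereal_scope.
Context {R : realType} {disp : measure_display} {Om : measurableType disp}.
Variable P : probability Om R.

Lemma Lfun2_Lfun1 (X : Om -> R) : X \in Lfun P 2%:E -> X \in Lfun P 1.
Proof. by apply: Lfun_subset12; rewrite fin_num_measure. Qed.

Lemma variance_le_expectation_sqr (X : Om -> R) : X \in Lfun P 2%:E ->
  'V_P[X] <= 'E_P[X * X].
Proof.
move=> X2; rewrite varianceE// expr2.
rewrite -(fineK (expectation_fin_num (Lfun2_Lfun1 X2))).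
rewrite -(fineK (expectation_fin_num (Lfun2_mul_Lfun1 X2 X2))).
by rewrite -EFin_expe -EFinB lee_fin gerBl sqr_ge0.
Qed.

(** Fatou's lemma for the squares of the [S n]: almost surely their lower limit is the square of
    [X], and their expectations tend to [l]. *)
Lemma expectation_sqr_le_lim (X : {RV P >-> R}) (S : nat -> {RV P >-> R})
    (v : nat -> R) (l : R) :
  {ae P, forall w, S n w @[n --> \oo] --> X w} ->
  (forall n, 'E_P[(S n : Om -> R) * S n] = (v n)%:E) ->
  v @ \oo --> l ->
  'E_P[(X : Om -> R) * X] <= l%:E.
Proof.
move=> SX ES vl.
pose f n w : \bar R := (S n w * S n w)%:E.
have mf n : measurable_fun setT (f n).
  by apply/measurable_EFinP; exact: measurable_funM.
have f0 n x : setT x -> 0 <= f n x by rewrite lee_fin -expr2 sqr_ge0.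
have := fatou P measurableT mf f0.
have -> : limn_einf (fun n => \int[P]_x f n x) = l%:E.
  apply: (cvg_limn_einf_sup _).1.
  have -> : (fun n => \int[P]_x f n x) = EFin \o v.
    by apply/funext => n /=; rewrite -ES unlock.
  by apply: cvg_EFin => //; exact: nearW.
apply: le_trans; rewrite unlock.
apply: ae_ge0_le_integral => //.
- by move=> x _; rewrite lee_fin -expr2 sqr_ge0.
- by apply/measurable_EFinP; exact: measurable_funM.
- move=> x _; rewrite limn_einf_lim; apply: lime_ge; first exact: is_cvg_einfs.
  by apply: nearW => n; apply: le_ereal_inf_tmp => _ [m _ <-]; exact: f0.
- rewrite /limn_einf; apply: measurableT_comp => //.
  by apply: measurable_fun_limn_esup => n; exact: measurableT_comp.
apply: filterS SX => w Sw _.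
rewrite (_ : limn_einf _ = (X w * X w)%:E)//.
by apply: (cvg_limn_einf_sup _).1; apply: cvg_EFin; [exact: nearW|exact: cvgM].
Qed.

End square_integrable.

(** * Variance of a series in an orthonormal sequence *)

Section orthonormal_series.
Context {R : realType} {disp : measure_display} {Om : measurableType disp}.
Variable P : probability Om R.
Variable eta : nat -> {RV P >-> R}.
Hypothesis eta2 : forall j, (eta j : Om -> R) \in Lfun P 2%:E.
Hypothesis eta_cov : forall i j,
  covariance P (eta i) (eta j) = ((i == j)%:R%:E)%E.
Hypothesis eta_mean : forall j, ('E_P[eta j] = 0)%E.
Variable c : nat -> R.

(** The lower index is kept free so that the variance formula also measures tails. *)
Let S n m : Om -> R := \sum_(n <= j < m) (c j \o* eta j).

Let Sw n m w : S n m w = \sum_(n <= j < m) c j * eta j w.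
Proof.
rewrite /S fct_sumE; apply: eq_bigr => j _.
by rewrite mulrC.
Qed.

Let term2 j : (c j \o* eta j) \in Lfun P 2%:E.
Proof. by apply: Lfun_scale => //; rewrite ler1n. Qed.

Let S2 n m : S n m \in Lfun P 2%:E.
Proof. by rewrite /S rpred_sum ?lee1n// => j _; exact: term2. Qed.

Let ES n m : ('E_P[S n m] = 0)%E.
Proof.
have [nm|mn] := leqP n m; last first.
  by rewrite /S big_geq ?(ltnW mn)// expectation_cst.
elim: m nm => [|m IH] nm; first by rewrite /S big_geq// expectation_cst.
move: nm; rewrite leq_eqVlt => /predU1P[<-|nm].
  by rewrite /S big_geq// expectation_cst.
rewrite /S big_nat_recr//= expectationD ?Lfun2_Lfun1//; last exact: (S2 n m).
by rewrite IH// add0e expectationZl ?Lfun2_Lfun1// eta_mean mule0.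
Qed.

Let cov_S n m k : (m <= k)%N -> (covariance P (S n m) (eta k) = 0)%E.
Proof.
have [nm|mn] := leqP n m; last first.
  by rewrite /S big_geq ?(ltnW mn)// covariance_cst_l.
elim: m nm => [|m IH] nm mk; first by rewrite /S big_geq// covariance_cst_l.
move: nm; rewrite leq_eqVlt => /predU1P[<-|nm].
  by rewrite /S big_geq// covariance_cst_l.
rewrite /S big_nat_recr//= covarianceDl//; last exact: (S2 n m).
rewrite IH ?(ltnW mk)// add0e covarianceZl.
- by rewrite eta_cov ltn_eqF// mule0.
- exact: Lfun2_Lfun1.
- exact: Lfun2_Lfun1.
- exact: Lfun2_mul_Lfun1.
Qed.

(** Pythagoras' theorem: by [cov_S] each new term is uncorrelated with the sum before it. *)
Let VS n m : ('V_P[S n m] = (\sum_(n <= j < m) c j ^+ 2)%:E)%E.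
Proof.
have [nm|mn] := leqP n m; last by rewrite /S !big_geq ?(ltnW mn)// variance_cst.
elim: m nm => [|m IH] nm; first by rewrite /S !big_geq// variance_cst.
move: nm; rewrite leq_eqVlt => /predU1P[<-|nm].
  by rewrite /S !big_geq// variance_cst.
rewrite /S big_nat_recr//= varianceD//; last exact: (S2 n m).
rewrite IH// varianceZ// /variance eta_cov eqxx mule1.
rewrite covarianceZr; last 3 first.
- exact/Lfun2_Lfun1/S2.
- exact: Lfun2_Lfun1.
- by apply: Lfun2_mul_Lfun1 => //; exact: S2.
by rewrite (cov_S n (leqnn m)) !mule0 adde0 big_nat_recr.
Qed.

Let ESS n m : ('E_P[S n m * S n m] = (\sum_(n <= j < m) c j ^+ 2)%:E)%E.
Proof. by rewrite -VS varianceE// ES expr2 expe2 mule0 sube0. Qed.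

(** Fatou's lemma along the tails bounds the second moment of [S 0 n - X] by [l - s n]. The case
    [n = 0] gives square integrability and a variance of at most [l]. Conversely, [S 0 n = X \+ D n]
    bounds [s n] by an expression that tends to the variance of [X]. *)
Lemma orthonormal_series_variance (X : {RV P >-> R}) (l : R) :
  {ae P, forall w, series (fun j => c j * eta j w) @ \oo --> X w} ->
  series (fun j => c j ^+ 2) @ \oo --> l ->
  (X : Om -> R) \in Lfun P 2%:E /\ ('V_P[X] = l%:E)%E.
Proof.
move=> SX sl; set s := series (fun j => c j ^+ 2) in sl.
have mS n m : measurable_fun setT (S n m).
  by have := S2 n m; rewrite inE => /andP[/[!inE]].
have mNS n m : measurable_fun setT (\- S n m) by exact: measurableT_comp.
(* [D n] is the limit in [m] of [S 0 n - S 0 (n + m)], which is minus a tail block: hence the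
   sign. *)
pose NS n m : {RV P >-> R} := HB.pack (\- S n m)
  (isMeasurableFun.Build _ _ _ _ _ (mNS n m)).
pose D n : {RV P >-> R} := HB.pack (S 0 n \- X)
  (isMeasurableFun.Build _ _ _ _ _
    (measurable_funB (mS 0 n) (measurable_funP X))).
have EDD n : ('E_P[(D n : Om -> R) * D n] <= (l - s n)%:E)%E.
  apply: (@expectation_sqr_le_lim _ _ _ _ _ (fun m => NS n (n + m)%N)
    (fun m => s (n + m)%N - s n)).
  - apply: filterS SX => w Sw'.
    have -> : (fun m => NS n (n + m)%N w) =
        (fun m => S 0 n w - series (fun j => c j * eta j w) (n + m)%N).
      apply/funext => m; rewrite -[LHS]/(- S n (n + m)%N w) !Sw.
      by rewrite -sub_series_geq ?leq_addr// opprB.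
    by apply: cvgB; [exact: cvg_cst|exact: cvg_comp (cvg_addnl n) Sw'].
  - move=> m; rewrite (_ : _ * _ = S n (n + m)%N * S n (n + m)%N); last first.
      by apply/funext => w; rewrite /= mulrNN.
    by rewrite ESS -sub_series_geq ?leq_addr.
  - by apply: cvgB; [exact: cvg_comp (cvg_addnl n) sl|exact: cvg_cst].
have D2 n : (D n : Om -> R) \in Lfun P 2%:E.
  by apply: Lfun2_expectation_sqr; rewrite (le_lt_trans (EDD n))// ltry.
have EXX : ('E_P[(X : Om -> R) * X] <= l%:E)%E.
  (* The sum is empty for [n = 0], so [D 0] is [- X]. *)
  have := EDD 0%N; rewrite /s /series/= big_geq// subr0.
  rewrite (_ : (D 0%N : Om -> R) * D 0%N = (X : Om -> R) * X)//.
  apply/funext => w; rewrite -[LHS]/((S 0 0 w - X w) * (S 0 0 w - X w)) Sw.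
  by rewrite big_geq// sub0r mulrNN.
have X2 : (X : Om -> R) \in Lfun P 2%:E.
  by apply: Lfun2_expectation_sqr; rewrite (le_lt_trans EXX)// ltry.
split=> //.
have VXfin := variance_fin_num X2; set x := fine 'V_P[X].
have x0 : 0 <= x by rewrite fine_ge0 ?variance_ge0.
(* Variance of a sum, with the covariance bounded by the product of the standard deviations. *)
have sx n : s n <= x + (l - s n) + 2 * (Num.sqrt x * Num.sqrt (l - s n)).
  have VD : ('V_P[D n] <= (l - s n)%:E)%E.
    exact: (le_trans (variance_le_expectation_sqr (D2 n)) (EDD n)).
  have := VS 0 n; rewrite (_ : S 0 n = (X : Om -> R) \+ D n); last first.
    by apply/funext => w /=; rewrite addrC subrK.
  rewrite varianceD// => VE.
  rewrite -lee_fin -/(series _ n) -[X in (X <= _)%E]VE.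
  rewrite (EFinD (x + _)) (EFinD x) !EFinM.
  rewrite fineK//; apply: leeD; first exact: leeD.
  rewrite lee_pmul2l//.
  apply: le_trans (covariance_le X2 (D2 n)) _.
  rewrite -(fineK VXfin) -/x lee_wpmul2l ?lee_fin ?sqrtr_ge0//.
  rewrite -[leRHS]/(sqrte (l - s n)%:E) lee_sqrt//.
  exact: le_trans (variance_ge0 _ _) VD.
have r0 : (fun n => l - s n) @ \oo --> 0.
  by rewrite -(subrr l); apply: cvgB => //; exact: cvg_cst.
apply/eqP; rewrite eq_le; apply/andP; split.
  exact: le_trans (variance_le_expectation_sqr X2) EXX.
rewrite -(fineK VXfin) lee_fin -/x.
apply: (ler_cvg_to sl (l' := x)); last by apply: nearW => n; exact: sx n.
rewrite -[x in X in _ --> X](_ :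
    x + 0 + 2 * (Num.sqrt x * Num.sqrt 0) = x); last first.
  by rewrite sqrtr0 !mulr0 !addr0.
apply: cvgD; first by apply: cvgD => //; exact: cvg_cst.
apply: cvgM; first exact: cvg_cst.
apply: cvgM; first exact: cvg_cst.
exact: (cvg_comp _ _ r0 (@sqrt_continuous R 0)).
Qed.

End orthonormal_series.

(** * Covariance of two series in the same orthonormal sequence *)

Section orthonormal_series_covariance.
Context {R : realType} {disp : measure_display} {Om : measurableType disp}.
Variable P : probability Om R.
Variable eta : nat -> {RV P >-> R}.
Hypothesis eta2 : forall j, (eta j : Om -> R) \in Lfun P 2%:E.
Hypothesis eta_cov : forall i j,
  covariance P (eta i) (eta j) = ((i == j)%:R%:E)%E.
Hypothesis eta_mean : forall j, ('E_P[eta j] = 0)%E.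

(** Polarization: the variance formula for [X], [Y] and [X \+ Y] determines the covariance, and the
    partial sums of [c j * c' j] obey the same identity. *)
Lemma orthonormal_series_covariance (c c' : nat -> R) (X Y : {RV P >-> R}) :
  {ae P, forall w, series (fun j => c j * eta j w) @ \oo --> X w} ->
  {ae P, forall w, series (fun j => c' j * eta j w) @ \oo --> Y w} ->
  cvgn (series (fun j => c j ^+ 2)) -> cvgn (series (fun j => c' j ^+ 2)) ->
  series (fun j => c j * c' j) @ \oo --> fine (covariance P X Y).
Proof.
move=> cX cY c2 c'2.
have sumS (n : nat) : series (fun j => (c j + c' j) ^+ 2) n =
    series (fun j => c j ^+ 2) n + series (fun j => c' j ^+ 2) n +
    2 * series (fun j => c j * c' j) n.
  rewrite /series/= mulr_sumr -!big_split/=; apply: eq_bigr => j _.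
  by ring.
(* Comparison through [(c + c')^2 <= 2 c^2 + 2 c'^2]. *)
have cc'2 : cvgn (series (fun j => (c j + c' j) ^+ 2)).
  apply: (@series_le_cvg _ _ (fun j => 2 * (c j ^+ 2) + 2 * (c' j ^+ 2))).
  - by move=> n; exact: sqr_ge0.
  - by move=> n; rewrite addr_ge0// mulr_ge0// sqr_ge0.
  - by move=> n; have := sqr_ge0 (c n - c' n); lra.
  rewrite (_ : series _ = 2 \*: series (fun j => c j ^+ 2) \+
      2 \*: series (fun j => c' j ^+ 2)); last first.
    by apply/funext => n; rewrite /series/= big_split/= -!mulr_sumr.
  by apply: is_cvgD; exact: is_cvgZr.
have [X2 VX] := orthonormal_series_variance eta2 eta_cov eta_mean cX c2.
have [Y2 VY] := orthonormal_series_variance eta2 eta_cov eta_mean cY c'2.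
have cXY : {ae P, forall w,
    series (fun j => (c j + c' j) * eta j w) @ \oo --> (X \+ Y) w}.
  apply: filterS2 cX cY => w Xw Yw.
  rewrite (_ : series _ = series (fun j => c j * eta j w) \+
    series (fun j => c' j * eta j w)); first exact: cvgD.
  apply/funext => n; rewrite /series/= -big_split/=.
  by apply: eq_bigr => j _; rewrite mulrDl.
have [XY2 VXY] := orthonormal_series_variance (X := X \+ Y)
  eta2 eta_cov eta_mean cXY cc'2.
have := VXY; rewrite varianceD// VX VY.
have := covariance_fin_num (Lfun2_Lfun1 X2) (Lfun2_Lfun1 Y2)
  (Lfun2_mul_Lfun1 X2 Y2).
move=> /fineK <-; set k := fine _; rewrite -!EFinM -!EFinD => -[kE].
set u := series (fun j => (c j + c' j) ^+ 2) in cc'2 sumS kE *.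
have kE' : k = 2^-1 * (limn u - limn (series (fun j => c j ^+ 2))
    - limn (series (fun j => c' j ^+ 2))).
  by rewrite -kE; lra.
rewrite kE' (_ : series _ = fun n => 2^-1 * (u n - series (fun j => c j ^+ 2) n
    - series (fun j => c' j ^+ 2) n)); last first.
  by apply/funext => n; rewrite sumS; lra.
by apply: cvgM; [exact: cvg_cst|apply: cvgB => //; exact: cvgB].
Qed.

End orthonormal_series_covariance.

(** * Covariance matrix and shape of the errors under Assumption A *)

Section linear_process.
Context {R : realType} {disp : measure_display} {Om : measurableType disp}.
Variable P : probability Om R.

(** The variance of a centred variable is its second moment, which is finite here. *)
Lemma mean0_variance1_Lfun2 (X : {RV P >-> R}) :
  ('E_P[X] = 0)%E -> ('V_P[X] = 1)%E -> (X : Om -> R) \in Lfun P 2%:E.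
Proof.
rewrite /variance covariance.unlock => X0 V1; apply: Lfun2_expectation_sqr.
move: V1; rewrite X0/=.
rewrite (_ : (_ \- _)%R = X); first by move=> ->; rewrite ltry.
by apply/funext => w /=; rewrite subr0.
Qed.

Lemma independent_standardized_covariance (eta : nat -> {RV P >-> R}) :
  independent_elements P (measurable : set (set R))
    (fun j => eta j : Om -> R) ->
  (forall j, 'E_P[eta j] = 0)%E -> (forall j, 'V_P[eta j] = 1)%E ->
  forall i j, covariance P (eta i) (eta j) = ((i == j)%:R%:E)%E.
Proof.
move=> ind E0 V1 i j.
have e2 k := mean0_variance1_Lfun2 (E0 k) (V1 k).
have e1 k := Lfun2_Lfun1 (e2 k).
have [->|ij] := eqVneq i j; first exact: V1.
have e11 := Lfun2_mul_Lfun1 (e2 i) (e2 j).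
rewrite covarianceE// expectation_indepM ?E0 ?mule0 ?sube0//.
exact: independent_elements_pair.
Qed.

(** This is [Sigma = sum_j a_j a_j^T] read entrywise: components [k] and [l] of the error are series
    in the same orthonormal sequence. *)
Lemma assumption_A_covmx (T : nat)
    (eta : forall d : nat, 'I_T -> nat -> {RV P >-> R})
    (a : forall d : nat, nat -> 'cV[R]_d)
    (e : forall d : nat, 'I_T -> 'I_d -> {RV P >-> R}) :
  assumption_A eta a e -> forall d t k l,
  series (fun j => a d j k 0 * a d j l 0) @ \oo --> covmx (e d t) k l.
Proof.
move=> HA d t k l; rewrite mxE.
have E0 := eta_mean HA d t; have V1 := eta_variance HA d t.
apply: (@orthonormal_series_covariance _ _ _ _ (eta d t)).
- by move=> j; exact: mean0_variance1_Lfun2.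
- by apply: independent_standardized_covariance => //; exact: (eta_indep HA).
- exact: E0.
- exact: (e_expansion HA t k).
- exact: (e_expansion HA t l).
- exact: (a_square_summable HA).
- exact: (a_square_summable HA).
Qed.

(** A nonzero coordinate [l0] of [Delta] recovers the scalar factor as [e d t l0] divided by
    [Delta l0 0]; proportionality of the other components holds term by term, hence in the limit. *)
Lemma proportional_factor_errors (T : nat)
    (eta : forall d : nat, 'I_T -> nat -> {RV P >-> R})
    (a : forall d : nat, nat -> 'cV[R]_d)
    (e : forall d : nat, 'I_T -> 'I_d -> {RV P >-> R}) :
  assumption_A eta a e -> forall d (Delta : 'cV[R]_d) (t : 'I_T),
  Delta != 0 -> one_proportional_factor (a d) Delta ->
  exists xi : {RV P >-> R},
    {ae P, forall w, forall l : 'I_d, e d t l w = xi w * Delta l 0}.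
Proof.
move=> HA d Delta t /eqP Delta0 aD.
have [l0 Dl0] : exists l0, Delta l0 0 != 0.
  apply: contrapT => /forallNP D0; apply: Delta0; apply/colP => l; rewrite mxE.
  by apply/eqP/negP => /negP; exact: D0.
exists ((Delta l0 0)^-1 \o* (e d t l0 : Om -> R)).
have := e_expansion HA t => He.
(* There are finitely many components, so one null set serves them all. *)
have {}He : {ae P, forall w, forall l : 'I_d,
    series (fun j => a d j l 0 * eta d t j w) @ \oo --> e d t l w}.
  exact: filter_forall.
apply: filterS He => w He l /=.
have [c cE] : exists c : nat -> R, forall j, a d j = c j *: Delta.
  by have [c] := choice aD; exists c.
suff H : Delta l0 0 * e d t l w = Delta l 0 * e d t l0 w.
  by rewrite mulrAC [_ * Delta l 0]mulrC -H mulrAC mulfV// mul1r.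
apply: (cvg_unique _ (F := (fun n => Delta l0 0 *
  series (fun j => a d j l 0 * eta d t j w) n) @ \oo)) => //.
  by apply: cvgM; [exact: cvg_cst|exact: He].
rewrite (_ : (fun n => _) = fun n => Delta l 0 *
    series (fun j => a d j l0 0 * eta d t j w) n); last first.
  apply/funext => n; rewrite /series/= !mulr_sumr; apply: eq_bigr => j _.
  by rewrite cE !mxE; ring.
by apply: cvgM; [exact: cvg_cst|exact: He].
Qed.

End linear_process.

(** * Traces and quadratic forms as series over the factors *)

Section factor_series.
Context {R : realType} {d : nat}.
Implicit Types (A W Sigma : 'M[R]_d) (u x y : 'cV[R]_d).

(** The trace of [W *m Sigma] is a finite linear combination of the entries of [Sigma], so entrywise
    convergence suffices. *)
Lemma mxtrace_series_cvg W (a : nat -> 'cV[R]_d) Sigma :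
  (forall k l, series (fun j => a j k 0 * a j l 0) @ \oo --> Sigma k l) ->
  series (fun j => \tr (W *m (a j *m (a j)^T))) @ \oo --> \tr (W *m Sigma).
Proof.
move=> aS.
rewrite (_ : series _ = fun n =>
    \sum_k \sum_l W k l * series (fun j => a j l 0 * a j k 0) n); last first.
  apply/funext => n; rewrite /series/=.
  under [RHS]eq_bigr do under eq_bigr do rewrite mulr_sumr.
  under [RHS]eq_bigr do rewrite exchange_big/=.
  rewrite exchange_big/=; apply: eq_bigr => j _; rewrite /mxtrace.
  apply: eq_bigr => k _; rewrite mxE; apply: eq_bigr => l _.
  by rewrite !mxE big_ord1 mxE.
rewrite (_ : \tr _ = \sum_k \sum_l W k l * Sigma l k); last first.
  by apply: eq_bigr => k _; rewrite mxE.
apply: cvg_big => [|k _]; first exact: add_continuous.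
apply: cvg_big => [|l _]; first exact: add_continuous.
by apply: cvgM; [exact: cvg_cst|exact: aS].
Qed.

Lemma mxtrace_rank1 W x y : \tr (W *m (x *m y^T)) = inner y (W *m x).
Proof. by rewrite mulmxA mxtrace_mulC /mxtrace big_ord1. Qed.

(* The difference is the trace of [W *m Sigma] for
   [W = inner u u *: (A *m A) - (A *m u) *m (A *m u)^T], that is, the sum over
   the factors of the Cauchy-Schwarz gaps of [u] and [A *m a j]. *)
Lemma trace_bound A (a : nat -> 'cV[R]_d) Sigma u :
  A^T = A -> u != 0 ->
  (forall k l, series (fun j => a j k 0 * a j l 0) @ \oo --> Sigma k l) ->
  let gap := inner u u * \tr (A *m Sigma *m A)
             - inner (A *m u) (Sigma *m (A *m u)) in
  0 <= gap /\ (gap = 0 <-> forall j, exists c, A *m a j = c *: u).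
Proof.
move=> Asym u0 aS gap.
pose W : 'M[R]_d := inner u u *: (A *m A) - (A *m u) *m (A *m u)^T.
have gapE : gap = \tr (W *m Sigma).
  rewrite /gap /W mulmxBl linearB/= -scalemxAl linearZ/=; congr (_ * _ - _).
    by rewrite mxtrace_mulC mulmxA.
  by rewrite mxtrace_mulC mxtrace_rank1.
have qE j : \tr (W *m (a j *m (a j)^T)) =
    inner u u * inner (A *m a j) (A *m a j) - inner u (A *m a j) ^+ 2.
  rewrite mxtrace_rank1 /W mulmxBl innerBr -scalemxAl innerZr.
  congr (_ * _ - _).
    by rewrite -mulmxA [inner (a j) _]inner_mulmxr Asym.
  (* [(A *m u)^T *m a j] is a 1 by 1 matrix and is pulled out as a scalar. *)
  rewrite -[_ *m _ *m a j]mulmxA [_^T *m a j]mx11_scalar mul_mx_scalar.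
  rewrite -/(inner _ _) innerZr [inner (a j) _]innerC [inner u _]inner_mulmxr.
  by rewrite Asym expr2.
have q0 j : 0 <= \tr (W *m (a j *m (a j)^T)) by rewrite qE Cauchy_Schwarz.
have [g0 gq] := nonneg_series_lim q0 (mxtrace_series_cvg aS).
rewrite gapE; split=> //; rewrite gq; split=> aq j.
  by apply/scale_multipleP => //; rewrite -qE.
by rewrite qE; apply/scale_multipleP.
Qed.

(** For [W = x *m x^T] the trace series is the sum of the squares of [inner x (a j)]. *)
Lemma quadratic_form_ge0 (a : nat -> 'cV[R]_d) Sigma x :
  (forall k l, series (fun j => a j k 0 * a j l 0) @ \oo --> Sigma k l) ->
  0 <= inner x (Sigma *m x).
Proof.
move=> aS; rewrite -mxtrace_rank1 mxtrace_mulC.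
refine (nonneg_series_lim _ (mxtrace_series_cvg aS)).1 => j.
rewrite mxtrace_rank1 -mulmxA [_^T *m a j]mx11_scalar mul_mx_scalar.
by rewrite -/(inner _ _) innerZr [inner (a j) _]innerC -expr2 sqr_ge0.
Qed.

End factor_series.

Theorem theorem2p9 (R : realType) (disp : measure_display)
    (Om : measurableType disp) (P : probability Om R)
    (T : nat) (T_gt0 : (0 < T)%N)
    (eta : forall d : nat, 'I_T -> nat -> {RV P >-> R})
    (a : forall d : nat, nat -> 'cV[R]_d)
    (e : forall d : nat, 'I_T -> 'I_d -> {RV P >-> R})
    (HA : assumption_A eta a e)
    (d : nat) (M : 'M[R]_d) (Delta : 'cV[R]_d) :
  let Sigma := covmx (e d (Ordinal T_gt0)) in
  let o_M := misscaled_oracle M Delta in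
  let bound := enorm (invsqrtmx M *m Delta) ^+ 2 /
               \tr (invsqrtmx M *m Sigma *m invsqrtmx M) in
  sym_posdef M ->
  Delta != 0 ->
  inner o_M (Sigma *m o_M) != 0 ->
  [/\ efficiency Sigma Delta o_M ^+ 2 >= bound,
      efficiency Sigma Delta o_M ^+ 2 = bound
        <-> one_proportional_factor (a d) Delta
    & one_proportional_factor (a d) Delta ->
      forall t : 'I_T, exists xi : {RV P >-> R},
        {ae P, forall w, forall l : 'I_d, e d t l w = xi w * Delta l 0}].
Proof.
move=> Sigma o_M bound Mpd Delta0 tau0.
have aS k l : series (fun j => a d j k 0 * a d j l 0) @ \oo --> Sigma k l.
  exact: (assumption_A_covmx HA).
pose L := invsqrtmx M; pose u := L *m Delta.
have Lsym : L^T = L by exact: invsqrtmx_sym.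
have LU : L \in unitmx by exact: invsqrtmx_unit.
have oE : o_M = L *m u.
  by rewrite /o_M /misscaled_oracle -invsqrtmx_sqr// -mulmxA.
have u0 : u != 0.
  by apply: contraNneq Delta0 => u0; rewrite -[Delta](mulKmx LU) -/u u0 mulmx0.
have [gap_ge0 gap_eq0] := trace_bound Lsym u0 aS.
(* The hypothesis excludes zero; the sign comes from [quadratic_form_ge0]. *)
have tau_gt0 : 0 < inner o_M (Sigma *m o_M).
  by rewrite lt_def tau0 (quadratic_form_ge0 _ aS).
(* [inner Delta o_M] equals [inner u u], because [o_M = L *m u] and [L] is symmetric. *)
have effE : efficiency Sigma Delta o_M ^+ 2 =
    inner u u ^+ 2 / inner o_M (Sigma *m o_M).
  rewrite /efficiency /tau expr_div_n sqr_sqrtr ?ltW// oE inner_mulmxr Lsym -/u.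
  by rewrite real_normK// num_real.
have boundE : bound = inner u u / \tr (L *m Sigma *m L).
  by rewrite /bound /enorm sqr_sqrtr ?inner_ge0.
rewrite -oE in gap_ge0 gap_eq0.
have uu := inner_gt0 u0.
rewrite effE boundE; set n := inner u u in uu gap_ge0 gap_eq0 *.
set t2 := inner o_M _ in tau_gt0 gap_ge0 gap_eq0 *.
set tr := \tr _ in gap_ge0 gap_eq0 *.
(* The trace is positive because [n * tr] dominates [t2], which is positive. *)
have ntr : 0 < n * tr by apply: lt_le_trans tau_gt0 _; rewrite -subr_ge0.
have tr_gt0 : 0 < tr by rewrite pmulr_rgt0 in ntr.
(* The two sides differ by a positive multiple of the gap in [trace_bound], which settles both the
   inequality and the case of equality. *)
have diffE : n ^+ 2 / t2 - n / tr = (n / (t2 * tr)) * (n * tr - t2).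
  by field; rewrite !gt_eqF.
have coef : 0 < n / (t2 * tr) by rewrite divr_gt0// mulr_gt0.
split.
- by rewrite -subr_ge0 diffE mulr_ge0// ltW.
- transitivity (n * tr - t2 = 0).
    split=> [/eqP|/eqP gap0]; last first.
      by apply/eqP; rewrite -subr_eq0 diffE (eqP gap0) mulr0.
    by rewrite -subr_eq0 diffE mulf_eq0 gt_eqF//= => /eqP.
  (* Cancelling the invertible [L] turns [L *m a j = c *: u] into [a j = c *: Delta] with the same
     [c]. *)
  rewrite gap_eq0; split=> aD j; have [c cE] := aD j; exists c.
    by apply: (can_inj (mulKmx LU)); rewrite cE -scalemxAr.
  by rewrite cE -scalemxAr.
- by move=> aD t; exact: (proportional_factor_errors HA).
Qed.
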